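(* Let $\alpha \in (0,1)$ and let $\gamma_n = \alpha n$ for each $n$. Let $K:\mathbb{N}_0 \to \mathbb{N}_0$, $n \mapsto K_n$, be a scaling such that for some constant $c>0$, \[ K_n \sim c \cdot r_1(\alpha,n), \qquad \text{where } r_1(\alpha,n) = \frac{\log n}{1-\alpha-\log \alpha}. \] Let $P(n,K_n,\gamma_n)$ denote the probability that the graph $\mathbb{H}(n;K_n,\gamma_n)$ is connected. Then \[ \lim_{n\to\infty} P(n,K_n,\gamma_n) = \begin{cases} 1, & \text{if } c>1,\\ 0, & \text{if } 0<c<1.\end{cases} \]
   Context: Random K-out graph $\mathbb{H}(n;K_n)$: on vertex set $V=\{v_1,\dots,v_n\}$ with labels $\mathcal{N}=\{1,\dots,n\}$, each node $v_i$ independently selects a set $\Gamma_{n,i}\subseteq \mathcal{N}\setminus\{i\}$ of $K_n$ distinct labels uniformly at random (the sets $\Gamma_{n,1},\dots,\Gamma_{n,n}$ are mutually independent). Distinct nodes $v_i,v_j$ are adjacent if $j\in\Gamma_{n,i}$ or $i\in\Gamma_{n,j}$ (undirected graph). The graph $\mathbb{H}(n;K_n,\gamma_n)$ is obtained by choosing a set $D\subset V$ of $\gamma_n$ nodes uniformly at random and deleting them: it has vertex set $R=V\setminus D$, and two distinct vertices of $R$ are adjacent iff they are adjacent in $\mathbb{H}(n;K_n)$. $\log$ is the natural logarithm; $a_n\sim b_n$ means $a_n/b_n\to 1$. All limits are as $n\to\infty$. *)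

(* Defs.v *)
From Stdlib Require Import Reals ZArith.
From mathcomp Require Import all_boot.
Set Implicit Arguments. Unset Strict Implicit. Unset Printing Implicit Defensive.

(* An outcome of the experiment on n nodes: the selections Gamma_i (one set of
   labels per node) and the deleted set D. Nodes/labels are 'I_n. *)
Definition outcome (n : nat) : finType :=
  ({ffun 'I_n -> {set 'I_n}} * {set 'I_n})%type.

Definition valid_outcome (n K g : nat) (w : outcome n) : bool :=
  [forall i : 'I_n, (#|w.1 i| == K) && (i \notin w.1 i)] && (#|w.2| == g).

Definition kout_adj (n : nat) (G : {ffun 'I_n -> {set 'I_n}}) : rel 'I_n :=
  fun i j => (i != j) && ((j \in G i) || (i \in G j)).

Definition surv_adj (n : nat) (w : outcome n) : rel 'I_n :=
  fun i j => [&& i \notin w.2, j \notin w.2 & kout_adj w.1 i j].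

Definition surv_connected (n : nat) (w : outcome n) : bool :=
  [forall x : 'I_n, forall y : 'I_n,
     (x \notin w.2) ==> (y \notin w.2) ==> connect (surv_adj w) x y].

(* P(n,K,g): probability (uniform over all valid outcomes, i.e. independent
   uniform K-subsets Gamma_i and independent uniform g-subset D) that
   H(n;K,g) is connected. *)
Definition P_conn (n K g : nat) : R :=
  Rdiv (INR #|[set w : outcome n | valid_outcome K g w && surv_connected w]|)
       (INR #|[set w : outcome n | valid_outcome K g w]|).

Definition gamma_of (alpha : R) (n : nat) : nat :=
  Z.to_nat (Int_part (Rmult alpha (INR n))).

Definition r1 (alpha : R) (n : nat) : R :=
  Rdiv (ln (INR n)) (Rminus (Rminus 1 alpha) (ln alpha)).

(* Main.v *)
Require Import Defs.
From Stdlib Require Import Reals ZArith Lra.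
From mathcomp Require Import all_boot.
From mathcomp Require Import zify.
Set Implicit Arguments. Unset Strict Implicit. Unset Printing Implicit Defensive.

(** Fix the deleted set [D], with [g = #|D|] and [m = n - g], and write
    [L = 1 - alpha - ln alpha].

    For [c > 1], a disconnected surviving graph has a set of [r <= m / 2]
    survivors with no edge to the other survivors.  For a given set this has
    probability at most [exp (r K (ln y + y - 1))] with [y = (g + r) / n], and
    the union bound over the ['C(m, r)] sets is a geometric series in [r] whose
    ratio tends to [0]: for [y] near [alpha] the exponent is near [- r K L],
    about [- c r ln n], which beats [n ^ r], and otherwise [r] is of order [n]
    and [exp (- r K (1 - alpha))] beats [2 ^ n].

    For [c < 1], the expected number [E] of isolated survivors is about
    [(1 - alpha) n exp (- K L)], hence about [n ^ (1 - c)], which tends to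
    infinity.  The second moment method gives
    [P_conn <= 1 / E + 2 K / (n - 1)]. *)

(* [zify] loads [ring_scope], which takes over the key [R]. *)
Delimit Scope R_scope with R.

(** * Counting selections with a prescribed range for each node *)

Definition draws (n K : nat) (B : 'I_n -> {set 'I_n}) :=
  [set G : {ffun 'I_n -> {set 'I_n}} |
     [forall i, (G i \subset B i) && (#|G i| == K)]].

Lemma card_draws_prod (n K : nat) (B : 'I_n -> {set 'I_n}) :
  #|draws K B| = \prod_(i < n) 'C(#|B i|, K).
Proof.
pose F i := [set A : {set 'I_n} | A \subset B i & #|A| == K].
have -> : #|draws K B| = #|(family F : simpl_pred {ffun 'I_n -> {set 'I_n}})|.
  apply: eq_card => G; rewrite inE; apply/forallP/familyP => H i.
    by have := H i; rewrite inE.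
  by have := H i; rewrite inE.
rewrite card_family foldrE big_map big_enum.
by apply: eq_bigr => i _; rewrite cards_draws.
Qed.

Definition selections (n K : nat) := draws K (fun i : 'I_n => [set~ i]).

Lemma card_selections (n K : nat) : #|selections n K| = 'C(n.-1, K) ^ n.
Proof.
rewrite card_draws_prod.
under eq_bigr => i _ do rewrite cardsC1 card_ord.
by rewrite prod_nat_const card_ord.
Qed.

(** This lets all later counting work with one fixed [D]: selections and deletion are independent,
    so only estimates uniform in [D] are needed. *)
Lemma card_valid_and (n K g : nat) (P : pred (outcome n)) :
  #|[set w : outcome n | valid_outcome K g w && P w]| =
  \sum_(D : {set 'I_n} | #|D| == g) #|[set G in selections n K | P (G, D)]|.
Proof.
rewrite -sum1_card.
rewrite (eq_bigl (fun w : outcome n => (w.2 \in [set D : {set 'I_n} | #|D| == g]) &&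
   (w.1 \in [set G in selections n K | P (G, w.2)]))); last first.
  case=> G D; rewrite !inE /= /valid_outcome /= andbAC andbC.
  congr (_ && (_ && _)); apply: eq_forallb => i.
  by rewrite subsetC sub1set inE andbC.
under [RHS]eq_bigl => D do rewrite -[_ == g]/(D \in [pred D : {set 'I_n} | #|D| == g]).
rewrite [RHS](eq_bigr (fun D => \sum_(G in [set G in selections n K | P (G, D)]) 1)); last first.
  by move=> D _; rewrite sum1_card.
rewrite [RHS](exchange_big_dep xpredT) //= pair_big_dep /=.
by apply: eq_bigl => -[G D]; rewrite !inE.
Qed.

(** * Selections under which a set of survivors is cut off *)

Section ConfinedSelections.
Variables (n K : nat) (D A U : {set 'I_n}).
Hypothesis sUD : U \subset ~: D.

(** A product form of isolation: the choices of distinct nodes are constrained separately, so the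
    count factorizes. Deleted nodes choose freely because their edges vanish, and the remaining
    survivors must avoid [U]. *)
Definition confined :=
  draws K (fun i => (if i \in U then A else if i \in D then setT else ~: U) :\ i).

Lemma card_confined (a : nat) : (forall i, i \in U -> #|A :\ i| = a) ->
  #|confined| =
  'C(a, K) ^ #|U| * ('C(n.-1, K) ^ #|D| * 'C(n.-1 - #|U|, K) ^ (n - #|D| - #|U|)).
Proof.
move=> cardA; rewrite card_draws_prod (bigID (mem U)) /=; congr (_ * _).
  rewrite (eq_bigr (fun=> 'C(a, K))); first by rewrite prod_nat_const.
  by move=> i Ui; rewrite Ui cardA.
rewrite (bigID (mem D)) /=; congr (_ * _).
  rewrite (eq_bigl (mem D)); last first.
    move=> i; rewrite andbC; apply: andb_idr => Di.
    by apply/negP => /(subsetP sUD); rewrite inE Di.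
  rewrite (eq_bigr (fun=> 'C(n.-1, K))); first by rewrite prod_nat_const.
  move=> i; rewrite -[mem D i]/(i \in D) => Di; rewrite Di.
  case: ifP => [/(subsetP sUD)|_]; first by rewrite inE Di.
  by rewrite setTD cardsC1 card_ord.
rewrite (eq_bigl (mem (~: (D :|: U)))); last first.
  by move=> i /=; rewrite !inE negb_or andbC.
rewrite (eq_bigr (fun=> 'C(n.-1 - #|U|, K))).
  rewrite prod_nat_const; congr (_ ^ _).
  rewrite cardsCs setCK cardsU card_ord.
  have -> : D :&: U = set0.
    by apply/eqP; rewrite setI_eq0 disjoint_sym disjoints_subset.
  by rewrite cards0 subn0 subnDA.
move=> i; rewrite !inE negb_or => /andP[/negbTE-> iU]; rewrite (negbTE iU).
have := cardsD1 i (~: U); rewrite inE iU [#|~: U|]cardsCs setCK card_ord => E.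
by rewrite -subn1 subnAC E add1n subn1.
Qed.

Definition detached (G : {ffun 'I_n -> {set 'I_n}}) :=
  [forall u in U, forall j, (j \notin A) ==> ~~ kout_adj G u j].

(** The hypothesis on [A] places a survivor outside [U] outside [A] as well, so such a node may not
    select a member of [U]. *)
Lemma detached_confined : A \subset D :|: U ->
  [set G in selections n K | detached G] \subset confined.
Proof.
move=> sA; apply/subsetP => G; rewrite inE => /andP[].
rewrite inE => /forallP vG /forall_inP dG; rewrite inE; apply/forallP => i.
have /andP[] := vG i; rewrite subsetC sub1set inE => iGi ->; rewrite andbT.
apply/subsetP => j jGi; rewrite !inE.
have ji : j != i by apply: contraTneq jGi => ->.
rewrite ji /=; case: ifP => Ui.
  have /forallP/(_ j) := dG i Ui; apply: contraLR => jA.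
  by rewrite jA /= /kout_adj eq_sym ji jGi.
case: ifP => Di; rewrite inE //; apply/negP => Uj.
have /forallP/(_ i) := dG j Uj; rewrite /kout_adj ji jGi orbT /= implybF negbK.
by move/(subsetP sA); rewrite inE Di Ui.
Qed.

End ConfinedSelections.

(** The second moment needs exact counts. With [A = D] the members of [U] select only deleted
    labels, which also excludes edges inside [U]; every node of [U] is then isolated. *)
Lemma detached_confinedE (n K : nat) (D U : {set 'I_n}) : U \subset ~: D ->
  [set G in selections n K | detached D U G] = confined K D D U.
Proof.
move=> sUD; apply/eqP; rewrite eqEsubset detached_confined ?subsetUl //=.
apply/subsetP => G; rewrite !inE => /forallP cG; apply/andP; split.
  apply/forallP => i; have /andP[sG ->] := cG i; rewrite andbT.
  by apply: subset_trans sG _; rewrite setDE subsetIr.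
apply/forall_inP => u Uu; apply/forallP => j; apply/implyP => jD.
apply/negP => /andP[uj /orP[jG | uG]].
  have /andP[/subsetP/(_ j jG)] := cG u.
  by rewrite Uu !inE (negbTE jD) andbF.
have /andP[/subsetP/(_ u uG)] := cG j.
have := subsetP sUD u Uu; rewrite inE => /negbTE uD.
by case: ifP => _; rewrite ?(negbTE jD) !inE ?uD ?Uu ?andbF.
Qed.

(** * Union bound over detached sets of survivors *)

Section UnionBound.
Variables (n K : nat) (D : {set 'I_n}).

(** The component [S] of one survivor and the set [T] of the other survivors have no edge between
    them. The smaller of the two is the witness. *)
Lemma disconnected_detached (G : {ffun 'I_n -> {set 'I_n}}) :
  ~~ surv_connected (G, D) ->
  exists S : {set 'I_n}, [/\ S \subset ~: D, S != set0,
    (#|S|).*2 <= n - #|D| & detached (D :|: S) S G].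
Proof.
rewrite negb_forall => /existsP[x]; rewrite negb_forall => /existsP[y].
rewrite !negb_imply => /and3P[/= xD yD nxy].
pose S := [set z in ~: D | connect (surv_adj (G, D)) x z].
pose T := ~: (D :|: S).
have sS : S \subset ~: D by apply/subsetP => z; rewrite !inE => /andP[].
have sT : T \subset ~: D by apply/subsetP => z; rewrite !inE negb_or => /andP[].
have nS : S != set0 by apply/set0Pn; exists x; rewrite !inE xD connect0.
have nT : T != set0.
  by apply/set0Pn; exists y; rewrite !inE negb_or yD /= (negbTE nxy).
have noedge u v : u \in S -> v \in T -> ~~ kout_adj G u v.
  rewrite !inE negb_or negb_and negbK => /andP[uD cu] /andP[vD].
  rewrite (negbTE vD) /= => ncv; apply: contra ncv => uv.
  by apply: connect_trans cu (connect1 _); rewrite /surv_adj /= uD vD.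
have kC u v : kout_adj G u v = kout_adj G v u.
  by rewrite /kout_adj eq_sym orbC.
have cST : #|S| + #|T| = n - #|D|.
  have := cardsC (D :|: S); rewrite -/T card_ord cardsU.
  have -> : D :&: S = set0.
    by apply/eqP; rewrite setI_eq0 disjoint_sym disjoints_subset.
  rewrite cards0; lia.
have [le|lt] := leqP (#|S|).*2 (n - #|D|).
  exists S; split => //; apply/forall_inP => u Su; apply/forallP => j.
  by apply/implyP => jA; apply: noedge; rewrite // inE.
exists T; split => //.
  by move: cST lt; move: #|S| #|T| (n - #|D|) => s t m; lia.
apply/forall_inP => u Tu; apply/forallP => j; apply/implyP => jA.
rewrite kC; apply: noedge => //; move: jA.
rewrite in_setU negb_or => /andP[jD]; rewrite in_setC negbK in_setU.
by rewrite (negbTE jD).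
Qed.

(** The number of [r]-sets of survivors, times the number of confined selections for one such set
    [S] with [A] the union of [D] and [S]. *)
Definition cut_weight (r : nat) :=
  'C(n - #|D|, r) * ('C((#|D| + r).-1, K) ^ r *
    ('C(n.-1, K) ^ #|D| * 'C(n.-1 - r, K) ^ (n - #|D| - r))).

Lemma card_disconnected :
  #|[set G in selections n K | ~~ surv_connected (G, D)]| <=
  \sum_(r < n.+1 | (0 < r) && (r.*2 <= n - #|D|)) cut_weight r.
Proof.
pose Q := [pred S : {set 'I_n} |
  [&& S \subset ~: D, S != set0 & (#|S|).*2 <= n - #|D|]].
pose F S := [set G in selections n K | detached (D :|: S) S G].
apply: (@leq_trans (\sum_(S | Q S) #|F S|)).
  rewrite -sum1_card; apply: (@leq_trans (\sum_(G : {ffun 'I_n -> {set 'I_n}}) \sum_(S | Q S) (G \in F S))).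
    rewrite big_mkcond; apply: leq_sum => G _; case: ifP => //.
    rewrite inE => /andP[vG /disconnected_detached[S [sS nS cS dS]]].
    by rewrite (bigD1 S) /= ?sS ?nS ?cS // inE vG dS.
  rewrite exchange_big; apply: leq_sum => S _.
  by rewrite -sum1_card [X in _ <= X]big_mkcond; apply: leq_sum => G _; case: ifP.
have cF S : Q S -> #|F S| <= 'C((#|D| + #|S|).-1, K) ^ #|S| *
    ('C(n.-1, K) ^ #|D| * 'C(n.-1 - #|S|, K) ^ (n - #|D| - #|S|)).
  case/and3P => sS nS cS; apply: leq_trans (subset_leq_card (detached_confined _ _)) _ => //.
  rewrite (@card_confined n K D (D :|: S) S sS (#|D| + #|S|).-1) // => i iS.
  have := cardsD1 i (D :|: S); rewrite inE iS orbT cardsU.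
  have -> : D :&: S = set0.
    by apply/eqP; rewrite setI_eq0 disjoint_sym disjoints_subset.
  rewrite cards0; lia.
apply: leq_trans (leq_sum _ cF) _.
have leS (S : {set 'I_n}) : #|S| < n.+1 by rewrite ltnS -[X in _ <= X]card_ord max_card.
(* Group the sets by size; [inord] loses nothing because [#|S| <= n]. *)
rewrite (partition_big (fun S : {set 'I_n} => inord #|S| : 'I_n.+1)
  (fun r => (0 < r) && (r.*2 <= n - #|D|))) /=; last first.
  by move=> S /and3P[_]; rewrite -card_gt0 inordK // => -> ->.
apply: leq_sum => r _; rewrite /cut_weight.
set f := 'C((#|D| + r).-1, K) ^ r * _.
have -> : 'C(n - #|D|, r) = #|[set S : {set 'I_n} | S \subset ~: D & #|S| == r]|.
  by rewrite cards_draws [#|~: D|]cardsCs setCK card_ord.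
rewrite -sum_nat_const big_mkcond [X in _ <= X]big_mkcond; apply: leq_sum => S _.
case: ifP => // /andP[/and3P[sS _ _] /eqP rS].
have cS : #|S| = r by rewrite -rS inordK.
by rewrite inE sS cS eqxx.
Qed.

End UnionBound.

(** * Second moment of the number of isolated survivors *)

Lemma sum_sqr_le_card_support (I : finType) (A : {set I}) (X : I -> nat) :
  (\sum_(i in A) X i) ^ 2 <= #|[set i in A | 0 < X i]| * \sum_(i in A) X i ^ 2.
Proof.
set Z := [set i in A | 0 < X i].
(* A positive exponent matters here, since [0 ^ 0] is [1]. *)
have sumZ p : 0 < p -> \sum_(i in A) X i ^ p = \sum_(i in Z) X i ^ p.
  move=> p0; rewrite (bigID (fun i => 0 < X i)) /= [X in _ + X]big1 ?addn0.
    by apply: eq_bigl => i; rewrite inE.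
  by move=> i /andP[_]; rewrite -eqn0Ngt => /eqP->; rewrite exp0n.
have := sumZ 1 isT; under eq_bigr do rewrite expn1.
under [in RHS]eq_bigr do rewrite expn1.
move=> ->; rewrite (sumZ 2) //.
(* Cauchy-Schwarz on the support: expand twice the square as a double sum and bound each
   [2 * (X i * X j)] by [X i ^ 2 + X j ^ 2]. *)
rewrite -(leq_pmul2l (isT : 0 < 2)) -mulnn big_distrlr /=.
apply: (@leq_trans (\sum_(i in Z) \sum_(j in Z) (X i ^ 2 + X j ^ 2))).
  rewrite big_distrr /=; apply: leq_sum => i _.
  rewrite big_distrr /=; apply: leq_sum => j _; exact: nat_Cauchy.
under eq_bigr => i _ do rewrite big_split /= sum_nat_const.
by rewrite big_split /= sum_nat_const -big_distrr /= addnn mul2n.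
Qed.

Section IsolatedNodes.
Variables (n K : nat) (D : {set 'I_n}).

Let isolated v := [set G in selections n K | detached D [set v] G].
Let isolated_nodes (G : {ffun 'I_n -> {set 'I_n}}) :=
  [set v in ~: D | detached D [set v] G].

(** The number of selections isolating one given survivor; [two_isolated] does the same for two
    given survivors. The factors belong to the isolated nodes, the deleted nodes and the other
    survivors. *)
Definition one_isolated :=
  'C(#|D|, K) * ('C(n.-1, K) ^ #|D| * 'C(n.-1 - 1, K) ^ (n - #|D| - 1)).

Definition two_isolated :=
  'C(#|D|, K) ^ 2 * ('C(n.-1, K) ^ #|D| * 'C(n.-1 - 2, K) ^ (n - #|D| - 2)).

Let cardDD (U : {set 'I_n}) : U \subset ~: D -> forall i, i \in U -> #|D :\ i| = #|D|.
Proof.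
move=> sU i /(subsetP sU); rewrite inE => iD.
by rewrite [in RHS](cardsD1 i) (negbTE iD).
Qed.

Let card_isolated v : v \in ~: D -> #|isolated v| = one_isolated.
Proof.
move=> vD; have sU : [set v] \subset ~: D by rewrite sub1set.
rewrite /isolated detached_confinedE // (card_confined _ sU (cardDD sU)).
by rewrite cards1 expn1.
Qed.

Let card_isolated2 u v : u \in ~: D -> v \in ~: D -> u != v ->
  #|isolated u :&: isolated v| = two_isolated.
Proof.
move=> uD vD uv; have sU : [set u; v] \subset ~: D by rewrite subUset !sub1set uD vD.
have -> : isolated u :&: isolated v =
    [set G in selections n K | detached D [set u; v] G].
  apply/setP => G; rewrite !inE andbACA andbb; congr (_ && _).
  apply/andP/forall_inP => [[/forall_inP du /forall_inP dv] w|d].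
    by rewrite !inE => /orP[]/eqP->; [apply: du|apply: dv]; rewrite inE.
  by split; apply/forall_inP => w; rewrite inE => /eqP->; apply: d;
    rewrite !inE eqxx ?orbT.
rewrite detached_confinedE // (card_confined _ sU (cardDD sU)).
by rewrite cards2 uv.
Qed.

Let card_isolated_nodes G : G \in selections n K ->
  #|isolated_nodes G| = \sum_(v in ~: D) (G \in isolated v).
Proof.
move=> vG; rewrite -sum1_card big_mkcond [RHS]big_mkcond /=.
apply: eq_bigr => v _.
have -> : (G \in isolated v) = detached D [set v] G by rewrite inE vG.
by rewrite !inE; case: (v \in D) => //=; case: ifP.
Qed.

Let cardCD : #|~: D| = n - #|D|.
Proof. by rewrite cardsCs setCK card_ord. Qed.

Let sum_selections (A : {set {ffun 'I_n -> {set 'I_n}}}) :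
  A \subset selections n K ->
  \sum_(G in selections n K) (G \in A : nat) = #|A|.
Proof.
move=> sA; rewrite -sum1_card [RHS]big_mkcond [LHS]big_mkcond /=.
apply: eq_bigr => G _; case: ifP => // /negP vG.
by case: ifP => // /(subsetP sA).
Qed.

Let sub_isolated v : isolated v \subset selections n K.
Proof. by apply/subsetP => G; rewrite inE => /andP[]. Qed.

Let sum_isolated_nodes :
  \sum_(G in selections n K) #|isolated_nodes G| = (n - #|D|) * one_isolated.
Proof.
under eq_bigr => G vG do rewrite card_isolated_nodes //.
rewrite exchange_big -cardCD -sum_nat_const; apply: eq_bigr => v vD.
by rewrite sum_selections // card_isolated.
Qed.

Let sum_isolated_nodes_sqr :
  \sum_(G in selections n K) #|isolated_nodes G| ^ 2 =
  (n - #|D|) * one_isolated + (n - #|D|) * (n - #|D| - 1) * two_isolated.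
Proof.
under eq_bigr => G vG do rewrite card_isolated_nodes // -mulnn big_distrlr /=.
rewrite exchange_big -mulnA -mulnDr -cardCD -sum_nat_const.
(* Among the pairs with first member [v], the diagonal one contributes [one_isolated] and each other
   one [two_isolated]. *)
apply: eq_bigr => v vD; rewrite exchange_big /= (bigD1 v) //=.
have mulm (A B : {set {ffun 'I_n -> {set 'I_n}}}) G :
  (G \in A) * (G \in B) = (G \in A :&: B) :> nat by rewrite inE; case: (_ \in _); case: (_ \in _).
congr (_ + _).
  under eq_bigr do rewrite mulm setIid.
  by rewrite sum_selections // card_isolated.
rewrite (eq_bigr (fun=> two_isolated)).
  rewrite (eq_bigl (mem (~: D :\ v))) => [|u]; last by rewrite /= !inE andbC.
  by rewrite sum_nat_const (cardsD1 v (~: D)) vD add1n subn1.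
move=> u /andP[uD uv]; under eq_bigr do rewrite mulm.
rewrite sum_selections ?card_isolated2 // 1?eq_sym //.
by apply: subset_trans (subsetIl _ _) _.
Qed.

Lemma detached1_disconnected G v : 1 < n - #|D| -> v \in ~: D ->
  detached D [set v] G -> ~~ surv_connected (G, D).
Proof.
rewrite -cardCD inE => /card_gt1P[x [y [xD yD xy]]] vD dv.
have [u uD uv] : exists2 u, u \notin D & u != v.
  move: xD yD; rewrite !inE => xD yD; case: (eqVneq x v) => xv.
    by exists y; rewrite // -xv eq_sym.
  by exists x.
apply/negP => /forallP/(_ v)/forallP/(_ u); rewrite /= vD uD /=.
(* The first edge of a path from [v] to [u] would already lead to a surviving neighbour of [v]. *)
move/connectP => [[|w p]] /= ; first by move=> _ uE; rewrite uE eqxx in uv.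
case/andP=> /and3P[_ /= wD vw] _ _.
have /forall_inP/(_ v)/(_ (set11 v))/forallP/(_ w) := dv.
by rewrite wD vw.
Qed.

Lemma second_moment_disconnected : 1 < n - #|D| ->
  ((n - #|D|) * one_isolated) ^ 2 <=
  #|[set G in selections n K | ~~ surv_connected (G, D)]| *
  ((n - #|D|) * one_isolated + (n - #|D|) * (n - #|D| - 1) * two_isolated).
Proof.
move=> gt1; rewrite -sum_isolated_nodes_sqr -sum_isolated_nodes.
apply: leq_trans (sum_sqr_le_card_support _ _) _; rewrite leq_mul2r.
apply/orP; right; apply/subset_leq_card/subsetP => G; rewrite !inE.
case/andP=> -> /card_gt0P[v]; rewrite inE => /andP[vD dv].
exact: detached1_disconnected dv.
Qed.

End IsolatedNodes.

(** * Inequalities between binomial coefficients *)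

Lemma ffact_le_exp (n k : nat) : n ^_ k <= n ^ k.
Proof.
elim: k => [|k IH]; first by rewrite ffactn0.
by rewrite expnSr ffactnSr leq_mul ?leq_subr.
Qed.

(** The ratio of the binomials is a product of factors [(a - i) / (b - i)], each at most [a / b].
    Stated without division, it survives truncated subtraction. *)
Lemma bin_mul_exp_le (a b K : nat) : a <= b ->
  'C(a, K) * b ^ K <= 'C(b, K) * a ^ K.
Proof.
move=> ab; rewrite -(leq_pmul2r (fact_gt0 K)) mulnAC bin_ffact.
rewrite [X in _ <= X]mulnAC bin_ffact.
elim: K => [|K IH]; first by rewrite !ffactn0.
rewrite !ffactnSr !expnSr mulnACA [X in _ <= X]mulnACA.
by apply: leq_mul => //; rewrite !mulnBl [a * b]mulnC leq_sub2l // leq_mul2l ab orbT.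
Qed.

(** Each factor of [a ^_ K] is at least [a - K], and [b ^_ K] is at most [b ^ K]. *)
Lemma bin_mul_exp_ge (a b K : nat) :
  'C(b, K) * (a - K) ^ K <= 'C(a, K) * b ^ K.
Proof.
have lb k : k <= K -> (a - K) ^ k <= a ^_ k.
  elim: k => [|k IH] kK; first by rewrite ffactn0.
  by rewrite expnSr ffactnSr leq_mul ?leq_sub2l ?IH // ltnW.
rewrite -(leq_pmul2r (fact_gt0 K)) mulnAC bin_ffact [X in _ <= X]mulnAC bin_ffact.
by rewrite mulnC leq_mul ?lb ?ffact_le_exp.
Qed.

Lemma bin_le_exp (n r : nat) : 'C(n, r) <= n ^ r.
Proof.
by apply: leq_trans (ffact_le_exp n r); rewrite -bin_ffact leq_pmulr ?fact_gt0.
Qed.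

Lemma bin_le_exp2 (n r : nat) : 'C(n, r) <= 2 ^ n.
Proof.
elim: n r => [|n IH] [|r]; rewrite ?bin0 ?expn_gt0 ?bin0n //.
by rewrite binS expnS mul2n -addnn leq_add.
Qed.

Lemma bin_log_concave (N K : nat) :
  'C(N - 2, K) * 'C(N, K) <= 'C(N - 1, K) ^ 2.
Proof.
have [KN|NK] := leqP N K.
  case: N KN => [|[|N]] KN; first by rewrite expnS expn1 leq_mul.
    case: K KN => [|K] KN; first by rewrite !bin0.
    by rewrite bin0n.
  by rewrite bin_small ?subSS ?subn0 // ltnW.
case: N NK => [|[|N]] // NK; first by case: K NK.
rewrite !subSS !subn0 -mulnn.
have e1 := mul_bin_down N.+2 K; have e2 := mul_bin_down N.+1 K.
rewrite /= in e1 e2.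
(* Consecutive ratios are [(N.+1 - K) / N.+1] and [(N.+2 - K) / N.+2]. Clearing denominators leaves
   the comparison of these two fractions to [nia]. *)
rewrite -(@leq_pmul2l (N.+1 * (N.+2 - K))) ?muln_gt0 ?subn_gt0 //.
rewrite mulnACA e2 -e1 mulnACA leq_mul2r; apply/orP; right; nia.
Qed.

(** * Real exponential estimates for the union bound *)

Lemma INR_addn (a b : nat) : INR (a + b) = (INR a + INR b)%R.
Proof. exact: plus_INR. Qed.

Lemma INR_muln (a b : nat) : INR (a * b) = (INR a * INR b)%R.
Proof. exact: mult_INR. Qed.

Lemma INR_expn (a k : nat) : INR (a ^ k) = (INR a ^ k)%R.
Proof. by elim: k => //= k IH; rewrite expnS INR_muln IH. Qed.

Lemma INR_leq (a b : nat) : a <= b -> (INR a <= INR b)%R.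
Proof. by move/leP; exact: le_INR. Qed.

Lemma INR_subn (a b : nat) : b <= a -> INR (a - b) = (INR a - INR b)%R.
Proof. by move/leP; exact: minus_INR. Qed.

Lemma exp_pow_INR (x : R) (k : nat) : (exp x ^ k = exp (INR k * x))%R.
Proof.
elim: k => [|k IH]; first by rewrite /= Rmult_0_l exp_0.
rewrite S_INR /= IH -exp_plus; congr exp; ring.
Qed.

Lemma exp_le (x y : R) : (x <= y)%R -> (exp x <= exp y)%R.
Proof. by case=> [/exp_increasing/Rlt_le|->] //; exact: Rle_refl. Qed.

Lemma ln_le_sub1 (x : R) : (0 < x)%R -> (ln x <= x - 1)%R.
Proof. by move=> x0; have := exp_ineq1_le (ln x); rewrite exp_ln //; lra. Qed.

Lemma INR_bin_le (a b K : nat) (t : R) : a <= b -> 0 < b ->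
  (INR a <= INR b * exp t)%R ->
  (INR 'C(a, K) <= INR 'C(b, K) * exp (INR K * t))%R.
Proof.
move=> ab b0 h.
have bp : (0 < INR b ^ K)%R by apply: pow_lt; apply: lt_0_INR; apply/ltP.
apply: (Rmult_le_reg_r _ _ _ bp).
have := INR_leq (bin_mul_exp_le K ab); rewrite !INR_muln !INR_expn => h1.
apply: Rle_trans h1 _; rewrite Rmult_assoc [(exp _ * _)%R]Rmult_comm.
apply: Rmult_le_compat_l; first exact: pos_INR.
rewrite -exp_pow_INR -Rpow_mult_distr.
by apply: pow_incr; split => //; exact: pos_INR.
Qed.

Lemma INR_bin_sub1 (N K : nat) : K < N ->
  (INR 'C(N - 1, K) = INR 'C(N, K) * (1 - INR K / INR N))%R.
Proof.
move=> KN; have N0 : (0 < INR N)%R by apply: lt_0_INR; lia.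
have := congr1 INR (mul_bin_down N K); rewrite !INR_muln INR_subn; last by lia.
rewrite subn1 => h; apply: (Rmult_eq_reg_l (INR N)); last by lra.
by rewrite h; field; lra.
Qed.

(** Relative to free choice, the [r] nodes of the cut set cost a factor [y ^ (r K)]. Each of the
    other [n (1 - y)] survivors costs at most [exp (- K r / n)] for avoiding them. The product has
    exponent [r K (ln y + y - 1)]. *)
Lemma cut_weight_le (n K : nat) (D : {set 'I_n}) (r : nat) :
  0 < r -> r.*2 <= n - #|D| ->
  let y := (INR (#|D| + r) / INR n)%R in
  (INR (cut_weight K D r) <= INR 'C(n - #|D|, r) *
     (INR ('C(n.-1, K) ^ n) * exp (INR r * (INR K * (ln y + y - 1)))))%R.
Proof.
move=> r0 rn; rewrite /cut_weight; set g := #|D| in rn *; set y := (INR (g + r) / INR n)%R; cbv zeta.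
have gn : g + r <= n by lia.
have n2 : 2 <= n by lia.
have np : (0 < INR n)%R by apply: lt_0_INR; lia.
have y0 : (0 < y)%R.
  by apply: Rdiv_lt_0_compat => //; apply: lt_0_INR; lia.
have ye : (INR g + INR r = y * INR n)%R by rewrite /y INR_addn; field; lra.
have rp : (1 <= INR r)%R by apply: (INR_leq r0).
have gnR : (INR g + INR r <= INR n)%R by rewrite -INR_addn; apply: INR_leq.
have n1R : INR n.-1 = (INR n - 1)%R by rewrite -subn1 INR_subn //; lia.
(* Since [y <= 1], removing one label from both sides keeps the ratio at most [y]. *)
have b1 : (INR 'C((g + r).-1, K) <= INR 'C(n.-1, K) * exp (INR K * ln y))%R.
  apply: INR_bin_le; [lia|lia|rewrite exp_ln // n1R].
  rewrite -subn1 INR_subn ?INR_addn; last by lia.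
  rewrite ye [INR 1]/=; have : (y * INR n <= 1 * INR n)%R by lra.
  move/(Rmult_le_reg_r _ _ _ np); lra.
have b2 : (INR 'C(n.-1 - r, K) <= INR 'C(n.-1, K) * exp (INR K * - (INR r / INR n)))%R.
  apply: INR_bin_le; [lia|lia|].
  rewrite INR_subn; last by lia.
  rewrite n1R; apply: (Rle_trans _ ((INR n - 1) * (1 + - (INR r / INR n)))%R).
    have -> : ((INR n - 1) * (1 + - (INR r / INR n)) = INR n - 1 - INR r + INR r / INR n)%R.
      by field; lra.
    have : (0 < INR r / INR n)%R by apply: Rdiv_lt_0_compat; lra.
    lra.
  apply: Rmult_le_compat_l; last exact: exp_ineq1_le.
  have := INR_leq n2; rewrite [INR 2]/=; lra.
rewrite INR_muln; apply: Rmult_le_compat_l; first exact: pos_INR.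
rewrite !INR_muln !INR_expn.
set b := INR 'C(n.-1, K) in b1 b2 *.
have b0 : (0 <= b)%R by exact: pos_INR.
have p1 := pow_incr _ _ r (conj (pos_INR _) b1).
have p2 := pow_incr _ _ (n - g - r) (conj (pos_INR _) b2).
apply: (Rle_trans _ ((b * exp (INR K * ln y)) ^ r *
  (b ^ g * (b * exp (INR K * - (INR r / INR n))) ^ (n - g - r)))%R).
  apply: Rmult_le_compat => //; try by apply: pow_le; exact: pos_INR.
    by apply: Rmult_le_pos; apply: pow_le; [|exact: pos_INR].
  by apply: Rmult_le_compat_l => //; exact: pow_le.
rewrite !Rpow_mult_distr !exp_pow_INR.
have -> : (b ^ n = b ^ r * b ^ g * b ^ (n - g - r))%R.
  rewrite -!pow_add; congr (_ ^ _)%R; rewrite plusE; lia.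
have nE : (INR (n - g - r) = INR n * (1 - y))%R.
  rewrite INR_subn ?INR_subn; [|lia|lia].
  by rewrite Rmult_minus_distr_l Rmult_1_r [(INR n * y)%R]Rmult_comm -ye; ring.
rewrite nE.
have -> : (INR r * (INR K * (ln y + y - 1)) =
  INR r * (INR K * ln y) + INR n * (1 - y) * (INR K * - (INR r / INR n)))%R.
  by field; lra.
rewrite exp_plus; apply: Req_le; ring.
Qed.

Lemma geometric_sum_le (N : nat) (P : pred nat) (f : nat -> nat) (c q : R) :
  (0 <= c)%R -> (0 <= q <= 1 / 2)%R -> (forall r, P r -> INR (f r) <= c * q ^ r)%R ->
  (forall r, P r -> 0 < r) ->
  (INR (\sum_(r < N.+1 | P r) f r) <= c * (2 * q))%R.
Proof.
move=> c0 q0 H P0.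
(* The subtracted term makes the induction close: for [q <= 1 / 2] the new term [q ^ N.+1] is at
   most [2 * q ^ N.+1 - 2 * q ^ N.+2]. *)
suff : (INR (\sum_(r < N.+1 | P r) f r) <= c * (2 * q - 2 * q ^ N.+1))%R.
  move=> h; apply: Rle_trans h _; apply: Rmult_le_compat_l => //.
  have := pow_le q N.+1 (proj1 q0); lra.
elim: N => [|N IH].
  rewrite big_mkcond big_ord_recl big_ord0 /=; case: ifP => [/P0//|_] /=; lra.
have -> : \sum_(r < N.+2 | P r) f r =
    \sum_(r < N.+1 | P r) f r + (if P N.+1 then f N.+1 else 0).
  by rewrite big_mkcond big_ord_recr -big_mkcond.
have -> : (q ^ N.+2 = q * q ^ N.+1)%R by [].
have qN := pow_le q N.+1 (proj1 q0).
have : (INR (if P N.+1 then f N.+1 else 0%N) <= c * q ^ N.+1)%R.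
  by case: ifP => [/H//|_]; apply: Rmult_le_pos.
have : (0 <= c * (q ^ N.+1 * (1 - 2 * q)))%R.
  by apply: Rmult_le_pos => //; apply: Rmult_le_pos => //; lra.
rewrite INR_addn; move: IH; set x := INR (\sum_(_ < _ | _) _).
set z := INR (if _ then _ else _); move: (q ^ N.+1)%R => Q; lra.
Qed.

Lemma disconnected_le (n K : nat) (D : {set 'I_n}) (q : R) :
  (0 <= q <= 1 / 2)%R ->
  (forall r, 0 < r -> r.*2 <= n - #|D| ->
    let y := (INR (#|D| + r) / INR n)%R in
    (INR 'C(n - #|D|, r) * exp (INR r * (INR K * (ln y + y - 1))) <= q ^ r)%R) ->
  (INR #|[set G in selections n K | ~~ surv_connected (G, D)]| <=
   2 * q * INR #|selections n K|)%R.
Proof.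
move=> q0 H; apply: Rle_trans (INR_leq (card_disconnected K D)) _.
rewrite card_selections Rmult_comm.
apply: (@geometric_sum_le n (fun r => (0 < r) && (r.*2 <= n - #|D|)) (cut_weight K D)) => //.
    exact: pos_INR.
  move=> r /andP[r0 rn]; apply: Rle_trans (cut_weight_le K r0 rn) _.
  have := Rmult_le_compat_l _ _ _ (pos_INR ('C(n.-1, K) ^ n)) (H r r0 rn).
  cbv zeta; lra.
by move=> r /andP[].
Qed.

(** * From a fixed deleted set to the connection probability *)

Lemma card_selections_gt0 (n K : nat) : K < n -> (0 < INR #|selections n K|)%R.
Proof.
move=> Kn; apply: lt_0_INR; apply/ltP; rewrite card_selections expn_gt0 bin_gt0.
apply/orP; left; lia.
Qed.

Lemma INR_card_valid_le (n K g : nat) (P : pred (outcome n)) (e : R) :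
  (forall D : {set 'I_n}, #|D| = g ->
     INR #|[set G in selections n K | P (G, D)]| <= e * INR #|selections n K|)%R ->
  (INR #|[set w : outcome n | valid_outcome K g w && P w]| <=
   e * INR #|[set w : outcome n | valid_outcome K g w]|)%R.
Proof.
move=> H.
have -> : [set w : outcome n | valid_outcome K g w] =
   [set w : outcome n | valid_outcome K g w && xpredT w].
  by apply/setP => w; rewrite !inE andbT.
rewrite !card_valid_and.
elim/big_rec2: _ => [|D x y /eqP cD IH]; first by rewrite /=; lra.
have -> : [set G in selections n K | true] = selections n K.
  by apply/setP => G; rewrite inE andbT.
by have := H D cD; rewrite !INR_addn; lra.
Qed.

Lemma card_valid_gt0 (n K g : nat) : K < n -> g <= n ->
  (0 < INR #|[set w : outcome n | valid_outcome K g w]|)%R.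
Proof.
move=> Kn gn.
have -> : [set w : outcome n | valid_outcome K g w] =
   [set w : outcome n | valid_outcome K g w && xpredT w].
  by apply/setP => w; rewrite !inE andbT.
rewrite card_valid_and.
rewrite (eq_bigr (fun=> #|selections n K|)) => [|D _]; last first.
  by apply: eq_card => G; rewrite inE andbT.
rewrite (eq_bigl (mem [set D : {set 'I_n} | #|D| == g])) => [|D]; last by rewrite /= inE.
rewrite sum_nat_const INR_muln card_draws card_ord.
apply: Rmult_lt_0_compat; last exact: card_selections_gt0.
by apply: lt_0_INR; apply/ltP; rewrite bin_gt0.
Qed.

Lemma P_conn_ge0 (n K g : nat) : K < n -> g <= n -> (0 <= P_conn n K g)%R.
Proof.
move=> Kn gn; apply: Rle_mult_inv_pos; first exact: pos_INR.
exact: card_valid_gt0.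
Qed.

Lemma P_conn_le (n K g : nat) (e : R) : K < n -> g <= n ->
  (forall D : {set 'I_n}, #|D| = g ->
     INR #|[set G in selections n K | surv_connected (G, D)]| <=
     e * INR #|selections n K|)%R ->
  (P_conn n K g <= e)%R.
Proof.
move=> Kn gn H; have v0 := card_valid_gt0 Kn gn.
apply: (Rmult_le_reg_r _ _ _ v0); rewrite /P_conn /Rdiv Rmult_assoc Rinv_l; last by lra.
by rewrite Rmult_1_r; exact: (INR_card_valid_le (P := @surv_connected n)).
Qed.

Lemma P_conn_ge (n K g : nat) (e : R) : K < n -> g <= n ->
  (forall D : {set 'I_n}, #|D| = g ->
     INR #|[set G in selections n K | ~~ surv_connected (G, D)]| <=
     e * INR #|selections n K|)%R ->
  (1 - e <= P_conn n K g <= 1)%R.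
Proof.
move=> Kn gn H; split; last first.
  apply: P_conn_le => // D _; rewrite Rmult_1_l; apply: INR_leq.
  by apply/subset_leq_card/subsetP => G; rewrite inE => /andP[].
have v0 := card_valid_gt0 Kn gn.
have HB := INR_card_valid_le (P := fun w => ~~ surv_connected w) H.
have : INR #|[set w : outcome n | valid_outcome K g w]| =
  (INR #|[set w : outcome n | valid_outcome K g w && surv_connected w]| +
   INR #|[set w : outcome n | valid_outcome K g w && ~~ surv_connected w]|)%R.
  rewrite -INR_addn -(cardsID [set w | surv_connected w]); congr (INR (_ + _)).
    by apply: eq_card => w; rewrite !inE.
  by apply: eq_card => w; rewrite !inE andbC.
move=> E; apply: (Rmult_le_reg_r _ _ _ v0).
rewrite /P_conn /Rdiv Rmult_assoc Rinv_l; lra.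
Qed.

(** * Near-independence of isolation events, and the bound on connectivity *)

Lemma two_isolated_le (n K : nat) (D : {set 'I_n}) : 1 < n - #|D| ->
  two_isolated K D * #|selections n K| * 'C(n.-1 - 1, K) ^ 2 <=
  one_isolated K D ^ 2 * 'C(n.-1, K) ^ 2.
Proof.
rewrite card_selections /two_isolated /one_isolated.
set g := #|D|; set a := 'C(g, K); set b := 'C(n.-1, K).
set b1 := 'C(n.-1 - 1, K); set b2 := 'C(n.-1 - 2, K) => gt1.
have [k kE] : exists k, n - g = k.+2 by exists (n - g - 2); lia.
have -> : n - g - 1 = k.+1 by lia.
have -> : n - g - 2 = k by lia.
have -> : n = g + k.+2 by lia.
(* Log-concavity, used once for each of the [k] survivors outside the pair. The pair itself leaves
   the correction factor [(b / b1) ^ 2]. *)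
have lc : b2 ^ k * b ^ k <= b1 ^ k * b1 ^ k.
  rewrite -!expnMn; case: (k) => // j.
  by rewrite leq_exp2r // mulnn bin_log_concave.
rewrite !expnMn expnD [b ^ k.+2]expnS [b ^ k.+1]expnS [b1 ^ k.+1]expnS -!mulnn.
move: lc; move: (b ^ g) (b ^ k) (b1 ^ k) (b2 ^ k) => x y z t lc.
have := leq_mul (leqnn (a * a * x * x * b * b * b1 * b1)) lc; lia.
Qed.

(* Dividing the second-moment bound by the square of the number of selections
   gives [z (p^2 + E) >= E p^2], where [z] is the disconnection probability
   and [p = 1 - K / (n - 1)]. *)
Lemma connected_le (n K : nat) (D : {set 'I_n}) (E : R) :
  K < n.-1 -> 1 < n - #|D| -> (0 < E)%R ->
  (E * INR #|selections n K| <= INR ((n - #|D|) * one_isolated K D))%R ->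
  (INR #|[set G in selections n K | surv_connected (G, D)]| <=
   (/ E + 2 * (INR K / INR n.-1)) * INR #|selections n K|)%R.
Proof.
move=> Kn gt1 E0 HE.
have N0 : (0 < INR #|selections n K|)%R by apply: card_selections_gt0; lia.
have m1E := INR_leq (second_moment_disconnected K gt1).
have m2E := INR_leq (two_isolated_le K gt1).
have : INR #|selections n K| =
  (INR #|[set G in selections n K | surv_connected (G, D)]| +
   INR #|[set G in selections n K | ~~ surv_connected (G, D)]|)%R.
  rewrite -INR_addn -(cardsID [set G | surv_connected (G, D)]); congr (INR (_ + _)).
    by apply: eq_card => w; rewrite !inE.
  by apply: eq_card => w; rewrite !inE andbC.
have n0 : (0 < INR n.-1)%R by apply: lt_0_INR; lia.
have b0 : (0 < INR 'C(n.-1, K))%R by apply: lt_0_INR; apply/ltP; rewrite bin_gt0; lia.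
have x01 : (0 <= INR K / INR n.-1 < 1)%R.
  split; first by apply: Rle_mult_inv_pos => //; exact: pos_INR.
  apply: (Rmult_lt_reg_r _ _ _ n0); rewrite /Rdiv Rmult_assoc Rinv_l; last by lra.
  by rewrite Rmult_1_r Rmult_1_l; apply: lt_INR; lia.
have mm : (0 <= INR (n - #|D| - 1) <= INR (n - #|D|))%R.
  by split; [exact: pos_INR|apply: INR_leq; lia].
have m0 : (0 < INR (n - #|D|))%R by apply: lt_0_INR; lia.
move: m1E m2E HE; move: (one_isolated K D) (two_isolated K D) => o t.
rewrite !(INR_expn, INR_addn, INR_muln) (INR_bin_sub1 Kn).
move: (INR 'C(n.-1, K)) (INR K / INR n.-1)%R (INR #|selections n K|)
  (INR #|[set G in selections n K | surv_connected (G, D)]|)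
  (INR #|[set G in selections n K | ~~ surv_connected (G, D)]|)
  (INR (n - #|D|)) (INR (n - #|D| - 1)) (INR o)
  (INR t) (pos_INR #|[set G in selections n K | ~~ surv_connected (G, D)]|)
  (pos_INR o) (pos_INR t) b0 x01 N0 mm m0.
clear -E0 => b x N C Z m m' {}o {}t Z0 o0 t0 b0 x01 N0 mm m0 h1 h2 h3 NE.
have iE : (0 < / E)%R by exact: Rinv_0_lt_compat.
have [C0|C0] : (C <= 0 \/ 0 < C)%R by lra.
  apply: Rle_trans C0 _; apply: Rmult_le_pos; lra.
set M := (m * o)%R in h1 h3.
have EN : (0 < E * N)%R by exact: Rmult_lt_0_compat.
have M0 : (0 < M)%R by lra.
have NM : (N <= / E * M)%R.
  apply: (Rmult_le_reg_l E) => //; rewrite -Rmult_assoc Rinv_r; lra.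
set p := (1 - x)%R in h2.
have p01 : (0 < p <= 1)%R by rewrite /p; lra.
have h2' : (t * N * p ^ 2 <= o ^ 2)%R.
  apply: (Rmult_le_reg_r (b ^ 2)); first by apply: pow_lt.
  move: h2; rewrite Rpow_mult_distr; lra.
have p2 : (0 < p ^ 2 <= 1)%R.
  by split; [apply: pow_lt; lra|rewrite -(pow1 2); apply: pow_incr; lra].
have h4 : (m * m' * t * (N * p ^ 2) <= M ^ 2)%R.
  apply: (Rle_trans _ (m ^ 2 * (t * N * p ^ 2))%R); last first.
    rewrite /M Rpow_mult_distr; apply: Rmult_le_compat_l => //.
    by apply: pow_le; lra.
  have : (m * m' * (t * N * p ^ 2) <= m ^ 2 * (t * N * p ^ 2))%R.
    apply: Rmult_le_compat_r; last by rewrite /= Rmult_1_r; apply: Rmult_le_compat_l; lra.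
    by apply: Rmult_le_pos; [apply: Rmult_le_pos|]; lra.
  lra.
have Np : (0 < N * p ^ 2)%R by apply: Rmult_lt_0_compat; lra.
(* Multiply the second-moment bound [h1] by [N * p ^ 2], bound the pair term by [h4], and cancel one
   [M]. *)
have h5 : (M * (N * p ^ 2) <= Z * (N * p ^ 2 + M))%R.
  apply: (Rmult_le_reg_l M) => //.
  have e1 := Rmult_le_compat_r _ _ _ (Rlt_le _ _ Np) h1.
  have e2 := Rmult_le_compat_l _ _ _ Z0 h4.
  lra.
have h6 : (C * M <= C * (N * p ^ 2 + M))%R by apply: Rmult_le_compat_l; lra.
have h7 : (1 - p ^ 2 <= 2 * x)%R by rewrite /p; nra.
have h8 : (N * M * (1 - p ^ 2) <= N * M * (2 * x))%R.
  by apply: Rmult_le_compat_l => //; apply: Rmult_le_pos; lra.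
have h9 : (N * (N * p ^ 2) <= N * (/ E * M))%R.
  by apply: Rmult_le_compat_l; [lra|nra].
(* With [Z = N - C], [h5] becomes [C (N p^2 + M) <= N (N p^2) + N M (1 - p^2)]. The two terms on the
   right are bounded by [h9] and [h8]. *)
apply: (Rmult_le_reg_r M) => //; move: h5 h6 h8 h9; rewrite NE.
move: (p ^ 2)%R (/ E)%R => P e; lra.
Qed.

(** The isolated node selects only deleted labels, with probability at least
    [((g - K) / (n - 1)) ^ K], where [g = #|D|]; [exp u] stands for a lower bound on this base. Each
    other survivor avoids it with probability [1 - K / (n - 1)]. *)
Lemma isolated_mean_ge (n K : nat) (D : {set 'I_n}) (u : R) :
  K < n.-1 -> 1 < n - #|D| -> (INR n.-1 * exp u <= INR (#|D| - K))%R ->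
  (INR (n - #|D|) *
     exp (INR K * u - INR (n - #|D| - 1) * (INR K / (INR n.-1 - INR K))) *
     INR #|selections n K| <= INR ((n - #|D|) * one_isolated K D))%R.
Proof.
move=> Kn gt1 hu; rewrite card_selections INR_muln Rmult_assoc.
apply: Rmult_le_compat_l; first exact: pos_INR.
rewrite /one_isolated !(INR_muln, INR_expn).
have n0 : (0 < INR n.-1)%R by apply: lt_0_INR; lia.
have KnR : (INR K < INR n.-1)%R by apply: lt_INR; lia.
have b0 : (0 < INR 'C(n.-1, K))%R by apply: lt_0_INR; apply/ltP; rewrite bin_gt0; lia.
set b := INR 'C(n.-1, K) in b0 *.
have a_ge : (b * exp (INR K * u) <= INR 'C(#|D|, K))%R.
  have bp : (0 < INR n.-1 ^ K)%R by exact: pow_lt.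
  apply: (Rmult_le_reg_r _ _ _ bp).
  have := INR_leq (bin_mul_exp_ge #|D| n.-1 K); rewrite !INR_muln INR_expn INR_expn.
  apply: Rle_trans; rewrite -/b Rmult_assoc; apply: Rmult_le_compat_l; first by lra.
  rewrite -exp_pow_INR -Rpow_mult_distr Rmult_comm; apply: pow_incr; split => //.
  by apply: Rmult_le_pos; [lra|exact/Rlt_le/exp_pos].
have b1_ge : (b * exp (- (INR K / (INR n.-1 - INR K))) <= INR 'C(n.-1 - 1, K))%R.
  rewrite (INR_bin_sub1 Kn); apply: Rmult_le_compat_l; first by lra.
  rewrite exp_Ropp.
  (* Inverting turns [1 + x <= exp x] into a lower bound for [1 - K / (n - 1)]. *)
  have -> : (1 - INR K / INR n.-1 = / (1 + INR K / (INR n.-1 - INR K)))%R.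
    by field; lra.
  apply: Rinv_le_contravar; last exact: exp_ineq1_le.
  suff : (0 <= INR K / (INR n.-1 - INR K))%R by lra.
  by apply: Rle_mult_inv_pos; [exact: pos_INR|lra].
have p1 : (b ^ (n - #|D| - 1) *
    exp (- (INR (n - #|D| - 1) * (INR K / (INR n.-1 - INR K)))) <=
    INR 'C(n.-1 - 1, K) ^ (n - #|D| - 1))%R.
  rewrite Ropp_mult_distr_r -exp_pow_INR -Rpow_mult_distr.
  apply: pow_incr; split => //.
  by apply: Rmult_le_pos; [lra|exact/Rlt_le/exp_pos].
have -> : (b ^ n = b * (b ^ #|D| * b ^ (n - #|D| - 1)))%R.
  rewrite -pow_add -[(b * _)%R]/(b ^ _.+1)%R; congr (_ ^ _)%R; rewrite plusE; lia.
rewrite /Rminus exp_plus.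
apply: Rle_trans (Rmult_le_compat _ _ _ _ _ _ a_ge
  (Rmult_le_compat_l (b ^ #|D|) _ _ _ p1)).
- by apply: Req_le; rewrite /Rminus; ring.
- by apply: Rmult_le_pos; [lra|exact/Rlt_le/exp_pos].
- apply: Rmult_le_pos; first by apply: pow_le; lra.
  by apply: Rmult_le_pos; [apply: pow_le; lra|exact/Rlt_le/exp_pos].
- by apply: pow_le; lra.
Qed.

(** * Asymptotic comparisons *)

Definition eventually (P : nat -> Prop) := exists N, forall n, N <= n -> P n.

Lemma eventually_and (P Q : nat -> Prop) :
  eventually P -> eventually Q -> eventually (fun n => P n /\ Q n).
Proof.
move=> [N HN] [M HM]; exists (maxn N M) => n; rewrite geq_max => /andP[h1 h2].
by split; [exact: HN|exact: HM].
Qed.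

Lemma eventually_impl (P Q : nat -> Prop) :
  (forall n, P n -> Q n) -> eventually P -> eventually Q.
Proof. by move=> PQ [N HN]; exists N => n /HN/PQ. Qed.

Lemma eventually_INR_ge (M : R) : eventually (fun n => (M <= INR n)%R).
Proof.
have [N HN] := INR_unbounded M; exists N => n /INR_leq; lra.
Qed.

Lemma eventually_ln_ge (M : R) : eventually (fun n => (M <= ln (INR n))%R).
Proof.
apply: eventually_impl (eventually_INR_ge (exp M)) => n h.
rewrite -[X in (X <= _)%R](ln_exp M); case: h => [h|->]; last exact: Rle_refl.
by apply/Rlt_le/ln_increasing => //; exact: exp_pos.
Qed.

(** With [t = ln n / 2], [n = exp t ^ 2 >= t ^ 2], that is, [ln n ^ 2 <= 4 n]. Once
    [ln n >= 4 / eta], one factor of the logarithm can be divided out. *)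
Lemma eventually_ln_le (eta : R) : (0 < eta)%R ->
  eventually (fun n => (ln (INR n) <= eta * INR n)%R).
Proof.
move=> eta0; have := eventually_and (eventually_INR_ge 1) (eventually_ln_ge (4 / eta)).
apply: eventually_impl => n [n1 ln4].
have d0 : (0 < 4 / eta)%R by apply: Rdiv_lt_0_compat; lra.
set t := (ln (INR n) / 2)%R.
have nE : (INR n = exp t * exp t)%R.
  by rewrite -exp_plus -{1}[INR n]exp_ln ?/t; [congr exp; field|lra].
have h := exp_ineq1_le t; have t0 : (0 <= t)%R by rewrite /t; lra.
have h2 : (t * t <= INR n)%R by rewrite nE; apply: Rmult_le_compat; lra.
have h3 : (ln (INR n) * (4 / eta) <= 4 * INR n)%R.
  apply: (Rle_trans _ (ln (INR n) * ln (INR n))%R).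
    by apply: Rmult_le_compat_l; lra.
  have -> : ln (INR n) = (2 * t)%R by rewrite /t; field.
  lra.
apply: (Rmult_le_reg_r (4 / eta)) => //; apply: Rle_trans h3 _.
by apply: Req_le; field; lra.
Qed.

Lemma gamma_of_bounds (alpha : R) (n : nat) : (0 < alpha)%R ->
  (INR (gamma_of alpha n) <= alpha * INR n < INR (gamma_of alpha n) + 1)%R.
Proof.
move=> a0; rewrite /gamma_of; set x := (alpha * INR n)%R.
have x0 : (0 <= x)%R by apply: Rmult_le_pos; [lra|exact: pos_INR].
have [h1 h2] := base_Int_part x.
have z0 : (0 <= Int_part x)%Z.
  have : (-1 < Int_part x)%Z by apply: lt_IZR; lra.
  lia.
rewrite INR_IZR_INZ Z2Nat.id //; lra.
Qed.

(** * The two limits under the scaling of [K] *)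

Section Scaling.
Variables (alpha c : R) (K : nat -> nat).
Hypotheses (alpha_gt0 : (0 < alpha)%R) (alpha_lt1 : (alpha < 1)%R) (c_gt0 : (0 < c)%R).
Hypothesis K_sim : Un_cv (fun n => (INR (K n) / (c * r1 alpha n))%R) 1.

Let L := (1 - alpha - ln alpha)%R.

Lemma rate_gt0 : (0 < L)%R.
Proof. by rewrite /L; have := ln_le_sub1 alpha_gt0; lra. Qed.

Lemma scaling_bounds (e : R) : (0 < e)%R ->
  eventually (fun n => (c * (1 - e) * ln (INR n) <= INR (K n) * L <=
    c * (1 + e) * ln (INR n))%R).
Proof.
move=> e0; have [N HN] := K_sim e0; have L0 := rate_gt0.
have evN : eventually (fun n => N <= n) by exists N.
apply: eventually_impl (eventually_and evN (eventually_ln_ge 1)) => n [/leP Nn l1].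
have := HN n Nn; rewrite /R_dist /r1 -/L.
have d0 : (0 < c * (ln (INR n) / L))%R.
  by apply: Rmult_lt_0_compat => //; apply: Rdiv_lt_0_compat; lra.
move/Rabs_def2 => [h1 h2].
set q := (INR (K n) / _)%R in h1 h2.
have -> : (INR (K n) * L = q * (c * ln (INR n)))%R by rewrite /q; field; lra.
have cl : (0 < c * ln (INR n))%R by apply: Rmult_lt_0_compat; lra.
by split; rewrite Rmult_assoc Rmult_comm Rmult_assoc Rmult_comm; nra.
Qed.

Lemma scaling_ge (M : R) : eventually (fun n => (M <= INR (K n))%R).
Proof.
have L0 := rate_gt0.
have h := scaling_bounds (_ : 0 < 1 / 2)%R.
have := eventually_and (h ltac:(lra)) (eventually_ln_ge (M * L * 2 / c)).
apply: eventually_impl => n [[h1 _] h2].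
apply: (Rmult_le_reg_r L) => //.
have h3 := Rmult_le_compat_l _ _ _ (Rlt_le _ _ c_gt0) h2.
have e : (c * (M * L * 2 / c) = 2 * (M * L))%R by field; lra.
lra.
Qed.

Lemma scaling_le (eta : R) : (0 < eta)%R ->
  eventually (fun n => (INR (K n) <= eta * INR n)%R).
Proof.
move=> eta0; have L0 := rate_gt0.
have h := scaling_bounds Rlt_0_1.
have d0 : (0 < eta * L / (2 * c))%R.
  by apply: Rdiv_lt_0_compat; [exact: Rmult_lt_0_compat|lra].
have := eventually_and h (eventually_ln_le d0).
apply: eventually_impl => n [[_ h1] h2].
apply: (Rmult_le_reg_r L) => //; apply: Rle_trans h1 _.
have h3 := Rmult_le_compat_l (2 * c) _ _ ltac:(lra) h2.
have e : (2 * c * (eta * L / (2 * c) * INR n) = eta * INR n * L)%R by field; lra.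
lra.
Qed.

Lemma eventually_Un_cv (f : nat -> R) (l : R) :
  (forall e, (0 < e)%R -> eventually (fun n => (Rabs (f n - l) < e)%R)) ->
  Un_cv f l.
Proof.
by move=> H e /H[N HN]; exists N => n Nn; apply: HN; apply/leP.
Qed.

(* The exponent [ln y + y - 1] is increasing in [y = (g + r) / n].  It is close
   to [- L] for [y] close to [alpha], where ['C(m, r) <= n ^ r] suffices;
   elsewhere [r] is at least a multiple of [n] and ['C(m, r) <= 2 ^ n] does. *)
Lemma cut_term_le (q : R) : (1 < c)%R -> (0 < q)%R ->
  eventually (fun n => forall r, 0 < r -> r.*2 <= n - gamma_of alpha n ->
    let y := (INR (gamma_of alpha n + r) / INR n)%R in
    (INR 'C(n - gamma_of alpha n, r) *
       exp (INR r * (INR (K n) * (ln y + y - 1))) <= q ^ r)%R).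
Proof.
move=> c1 q0; have L0 := rate_gt0.
(* Eventually [K L >= (c + 1) / 2 * ln n], and [eps] is chosen so that
   [K (L - eps) >= (1 + kappa) ln n]. The slope of [ln y + y] at [alpha] is [1 + / alpha], so moving
   [y] up by [delta] costs at most [eps]. *)
pose kappa := ((c - 1) / 4)%R.
pose eps := (L * ((c - 1) / (2 * (c + 1))))%R.
pose delta := (eps / (1 + / alpha))%R.
have ia : (0 < / alpha)%R by exact: Rinv_0_lt_compat.
have eps0 : (0 < eps)%R.
  by apply: Rmult_lt_0_compat => //; apply: Rdiv_lt_0_compat; lra.
have delta0 : (0 < delta)%R by apply: Rdiv_lt_0_compat; lra.
have th0 : (0 < (c - 1) / (2 * c))%R by apply: Rdiv_lt_0_compat; lra.
have kappa0 : (0 < kappa)%R by rewrite /kappa; lra.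
have := eventually_and (scaling_bounds th0) (eventually_and
  (eventually_ln_ge (- ln q / kappa)) (scaling_ge ((/ delta - ln q) / (1 - alpha)))).
move/(eventually_and (eventually_INR_ge 1)).
apply: eventually_impl => n [n1 [[Kl _] [lnl Kq]]] r r0 rn; cbv zeta.
have [g1 g2] := gamma_of_bounds n alpha_gt0.
set g := gamma_of alpha n in rn g1 g2 *; set k := INR (K n) in Kl Kq *.
have gn : g + r <= n by lia.
set y := (INR (g + r) / INR n)%R.
have yn : (y * INR n = INR g + INR r)%R by rewrite /y INR_addn; field; lra.
have r1 : (1 <= INR r)%R by exact: (INR_leq r0).
have y0 : (0 < y)%R by apply: Rdiv_lt_0_compat; [rewrite INR_addn; have := pos_INR g|]; lra.
have k0 : (0 <= k)%R by exact: pos_INR.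
have y1 : (y <= (1 + alpha) / 2)%R.
  apply: (Rmult_le_reg_r (INR n)); first by lra.
  have : (INR (r.*2 + g) <= INR n)%R by apply: INR_leq; lia.
  rewrite INR_addn -addnn INR_addn yn; lra.
have qE : (q ^ r = exp (INR r * ln q))%R by rewrite -exp_pow_INR exp_ln.
have lnn : (0 <= ln (INR n))%R.
  by rewrite -ln_1; case: n1 => [/ln_increasing h|<-]; [apply/Rlt_le/h|]; lra.
(* Here [z] is the entropy per node of the cut set: [ln n] for [y] near [alpha], and [/ delta]
   otherwise. *)
suff [z [hz1 hz2]] : exists z, (INR 'C(n - g, r) <= exp (INR r * z))%R /\
    (z + k * (ln y + y - 1) <= ln q)%R.
  rewrite qE; apply: (Rle_trans _ (exp (INR r * z) * exp (INR r * (k * (ln y + y - 1))))%R).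
    by apply: Rmult_le_compat_r => //; exact/Rlt_le/exp_pos.
  rewrite -exp_plus -Rmult_plus_distr_l; apply: exp_le; apply: Rmult_le_compat_l => //.
  by lra.
have [small|large] := Rle_dec y (alpha + delta).
  exists (ln (INR n)); split.
    rewrite -exp_pow_INR exp_ln; last by lra.
    rewrite -INR_expn; apply: INR_leq; apply: leq_trans (bin_le_exp _ _) _.
    by case: (r) r0 => // j _; rewrite leq_exp2r // leq_subr.
  have lny : (ln y <= ln alpha + (y - alpha) * / alpha)%R.
    have := ln_le_sub1 (Rdiv_lt_0_compat _ _ y0 alpha_gt0).
    rewrite /Rdiv ln_mult // ln_Rinv //.
    have -> : (y * / alpha - 1 = (y - alpha) * / alpha)%R by field; lra.
    lra.
  have phi : (ln y + y - 1 <= - (L - eps))%R.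
    have : ((y - alpha) * (1 + / alpha) <= delta * (1 + / alpha))%R.
      by apply: Rmult_le_compat_r; lra.
    have -> : (delta * (1 + / alpha) = eps)%R by rewrite /delta; field; lra.
    rewrite /L; lra.
  have kphi := Rmult_le_compat_l _ _ _ k0 phi.
  have kL : ((1 + kappa) * ln (INR n) <= k * (L - eps))%R.
    have th2 : (0 < (c + 3) / (2 * (c + 1)))%R by apply: Rdiv_lt_0_compat; lra.
    have -> : (k * (L - eps) = k * L * ((c + 3) / (2 * (c + 1))))%R.
      by rewrite /eps; field; lra.
    have -> : ((1 + kappa) * ln (INR n) =
      c * (1 - (c - 1) / (2 * c)) * ln (INR n) * ((c + 3) / (2 * (c + 1))))%R.
      by rewrite /kappa; field; lra.
    by apply: Rmult_le_compat_r; lra.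
  have := Rmult_le_compat_l _ _ _ (Rlt_le _ _ kappa0) lnl.
  have -> : (kappa * (- ln q / kappa) = - ln q)%R by field; lra.
  lra.
(* Now [y > alpha + delta] and [g <= alpha n] give [r >= delta n], hence
   [2 ^ n <= exp n <= exp (r / delta)]. *)
exists (/ delta)%R; split.
  apply: (Rle_trans _ (exp (INR n))).
    apply: (Rle_trans _ (INR (2 ^ n))).
      apply: INR_leq; apply: leq_trans (bin_le_exp2 _ _) _.
      by rewrite leq_exp2l // leq_subr.
    rewrite INR_expn -[INR n]Rmult_1_r -exp_pow_INR.
    apply: pow_incr; have := exp_ineq1_le 1; rewrite [INR 2]/=; lra.
  apply: exp_le; apply: (Rmult_le_reg_r delta) => //.
  rewrite Rmult_assoc Rinv_l ?Rmult_1_r; last by lra.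
  have : ((alpha + delta) * INR n <= y * INR n)%R by apply: Rmult_le_compat_r; lra.
  lra.
have := ln_le_sub1 y0 => lny.
(* From [ln y <= y - 1] the exponent is at most [2 (y - 1)], and [y <= (1 + alpha) / 2]. *)
have phi : (ln y + y - 1 <= - (1 - alpha))%R by lra.
have kphi := Rmult_le_compat_l _ _ _ k0 phi.
have := Rmult_le_compat_r _ _ _ (_ : 0 <= 1 - alpha)%R Kq => /(_ ltac:(lra)).
have -> : ((/ delta - ln q) / (1 - alpha) * (1 - alpha) = / delta - ln q)%R.
  by field; lra.
lra.
Qed.

Lemma gamma_of_le (n : nat) : gamma_of alpha n <= n.
Proof.
have [h _] := gamma_of_bounds n alpha_gt0; have n0 := pos_INR n.
by apply/leP/INR_le; nra.
Qed.

Lemma scaling_lt : eventually (fun n => K n < n.-1).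
Proof.
have := eventually_and (scaling_le (_ : 0 < 1 / 2)%R) (eventually_INR_ge 3).
move=> /(_ ltac:(lra)); apply: eventually_impl => n [h1 h2].
have : (INR (K n + 1) < INR n)%R by rewrite INR_addn [INR 1]/=; lra.
by move/INR_lt; lia.
Qed.

Lemma P_conn_cvg1 : (1 < c)%R -> Un_cv (fun n => P_conn n (K n) (gamma_of alpha n)) 1.
Proof.
move=> c1; apply: eventually_Un_cv => e e0.
pose q := Rmin (1 / 2) (e / 4).
have q0 : (0 < q)%R by apply: Rmin_glb_lt; lra.
have [q1 q2] : (q <= 1 / 2)%R /\ (q <= e / 4)%R by split; [exact: Rmin_l|exact: Rmin_r].
apply: eventually_impl (eventually_and (cut_term_le c1 q0) scaling_lt).
move=> n [H Kn].
have Kn' : K n < n by lia.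
have [h1 h2] : (1 - 2 * q <= P_conn n (K n) (gamma_of alpha n) <= 1)%R.
  apply: P_conn_ge (gamma_of_le n) _ => // D gD.
  by apply: disconnected_le => [|r]; [lra|rewrite gD; exact: H].
by apply: Rabs_def1; lra.
Qed.

Lemma P_conn_cvg0 : (c < 1)%R -> Un_cv (fun n => P_conn n (K n) (gamma_of alpha n)) 0.
Proof.
move=> c1; apply: eventually_Un_cv => e e0; have L0 := rate_gt0.
(* Eventually [K L <= (1 + c) / 2 * ln n], and [eps] is chosen so that
   [K (L + 2 eps) <= (1 - kappa) ln n]. One [eps] pays for replacing [(g - K) / (n - 1)] by [alpha],
   the other for the avoidance factors. *)
pose kappa := ((1 - c) / 4)%R.
pose eps := (L * ((1 - c) / (4 * (1 + c))))%R.
have kappa0 : (0 < kappa)%R by rewrite /kappa; lra.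
have eps0 : (0 < eps)%R.
  by apply: Rmult_lt_0_compat => //; apply: Rdiv_lt_0_compat; lra.
have th0 : (0 < (1 - c) / (2 * c))%R by apply: Rdiv_lt_0_compat; lra.
have ex1 : (exp (- eps) < 1)%R by rewrite -exp_0; apply: exp_increasing; lra.
(* The gap between [alpha] and [alpha * exp (- eps)]: half of [eta * n] absorbs [K], the other half
   the rounding of [alpha n]. *)
pose eta := (alpha * (1 - exp (- eps)))%R.
have eta0 : (0 < eta)%R by apply: Rmult_lt_0_compat; lra.
have d1 : (0 < eta / 2)%R by lra.
have d2 : (0 < eps / (1 + eps) / 2)%R.
  by apply: Rdiv_lt_0_compat; [apply: Rdiv_lt_0_compat|]; lra.
have d3 : (0 < e / 16)%R by lra.
have := eventually_and (scaling_le d1) (eventually_and (scaling_le d2) (scaling_le d3)).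
move/(eventually_and scaling_lt)/(eventually_and (scaling_bounds th0)).
move/(eventually_and (eventually_ln_ge (ln (4 / e / (1 - alpha)) / kappa))).
move/(eventually_and (eventually_INR_ge (2 / eta))).
move/(eventually_and (eventually_INR_ge (2 / (eps / (1 + eps))))).
move/(eventually_and (eventually_INR_ge (2 + 2 / (1 - alpha)))).
apply: eventually_impl => n [nA [nB [nC [lnl [[_ Kl] [Kn [K1 [K2 K3]]]]]]]].
have [g1 g2] := gamma_of_bounds n alpha_gt0.
have gn := gamma_of_le n.
set g := gamma_of alpha n in g1 g2 gn *; set k := INR (K n) in Kl K1 K2 K3 *.
have k0 : (0 <= k)%R by exact: pos_INR.
have i1 : (0 < 2 / (1 - alpha))%R by apply: Rdiv_lt_0_compat; lra.
have n2 : (2 <= INR n)%R by lra.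
have n1E : INR n.-1 = (INR n - 1)%R.
  by rewrite -subn1 INR_subn //; apply/leP/INR_le; rewrite [INR 1]/=; lra.
have mE : INR (n - g) = (INR n - INR g)%R by rewrite INR_subn.
have m_ge : ((1 - alpha) * INR n <= INR (n - g))%R by rewrite mE; lra.
have gt1 : 1 < n - g.
  apply/leP/INR_le; apply: Rle_trans m_ge; rewrite [INR 2]/=.
  have -> : (1 + 1 = (1 - alpha) * (2 / (1 - alpha)))%R by field; lra.
  by apply: Rmult_le_compat_l; lra.
have Kn' : K n < n by lia.
have knR : (k < INR n.-1)%R by apply: lt_INR; lia.
have eta_n : (2 <= eta * INR n)%R.
  have := Rmult_le_compat_l _ _ _ (Rlt_le _ _ eta0) nC.
  have -> : (eta * (2 / eta) = 2)%R by field; lra.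
  lra.
have hu : (INR n.-1 * exp (ln alpha - eps) <= INR g - k)%R.
  rewrite /Rminus exp_plus exp_ln // n1E.
  have : (0 < alpha * exp (- eps))%R by apply: Rmult_lt_0_compat => //; exact: exp_pos.
  move: K1 eta_n; rewrite /eta; lra.
have gK : INR (g - K n) = (INR g - k)%R.
  rewrite INR_subn //; apply/leP/INR_le.
  have : (0 <= INR n.-1 * exp (ln alpha - eps))%R.
    by apply: Rmult_le_pos; [exact: pos_INR|exact/Rlt_le/exp_pos].
  rewrite -/k; lra.
rewrite -gK in hu.
(* Rounding down gives [n - g - 1 <= (1 - alpha) n], while [1 + K <= n * eps / (1 + eps)] gives
   [n - 1 - K >= n / (1 + eps)]. *)
have hv : (INR (n - g - 1) * (k / (INR n.-1 - k)) <= k * ((1 - alpha) * (1 + eps)))%R.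
  have -> : (INR (n - g - 1) * (k / (INR n.-1 - k)) = k * (INR (n - g - 1) / (INR n.-1 - k)))%R.
    by field; lra.
  apply: Rmult_le_compat_l => //; apply: (Rmult_le_reg_r (INR n.-1 - k)); first by lra.
  rewrite /Rdiv Rmult_assoc Rinv_l ?Rmult_1_r; last by lra.
  rewrite INR_subn; last by lia.
  apply: (Rle_trans _ ((1 - alpha) * INR n)%R); first by rewrite mE [INR 1]/=; lra.
  rewrite Rmult_assoc; apply: Rmult_le_compat_l; first by lra.
  have e1 := Rmult_le_compat_l (1 + eps) _ _ ltac:(lra) K2.
  have e2 := Rmult_le_compat_l (eps / (1 + eps)) _ _ ltac:(lra) nB.
  move: e1 e2.
  have -> : ((1 + eps) * (eps / (1 + eps) / 2 * INR n) = eps * INR n / 2)%R by field; lra.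
  have -> : (eps / (1 + eps) * (2 / (eps / (1 + eps))) = 2)%R by field; lra.
  move=> e1 e2; have := Rmult_le_compat_l (1 + eps) _ _ ltac:(lra) e2.
  have -> : ((1 + eps) * (eps / (1 + eps) * INR n) = eps * INR n)%R by field; lra.
  rewrite n1E; lra.
have kL : (k * (L + 2 * eps) <= (1 - kappa) * ln (INR n))%R.
  have th2 : (0 < (3 + c) / (2 * (1 + c)))%R by apply: Rdiv_lt_0_compat; lra.
  have -> : (k * (L + 2 * eps) = k * L * ((3 + c) / (2 * (1 + c))))%R.
    by rewrite /eps; field; lra.
  have -> : ((1 - kappa) * ln (INR n) =
      c * (1 + (1 - c) / (2 * c)) * ln (INR n) * ((3 + c) / (2 * (1 + c))))%R.
    by rewrite /kappa; field; lra.
  by apply: Rmult_le_compat_r; lra.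
(* The mean is at least [(1 - alpha) n ^ kappa], which eventually exceeds [4 / e]. Its inverse then
   contributes at most [e / 4], and the correlation term another [e / 4]. *)
have E_ge : (4 / e <= INR (n - g) *
    exp (k * (ln alpha - eps) - INR (n - g - 1) * (k / (INR n.-1 - k))))%R.
  apply: (Rle_trans _ ((1 - alpha) * INR n * exp (- ((1 - kappa) * ln (INR n))))%R).
    rewrite Rmult_assoc -{1}[INR n]exp_ln; last by lra.
    rewrite -exp_plus.
    have -> : (ln (INR n) + - ((1 - kappa) * ln (INR n)) = kappa * ln (INR n))%R by ring.
    have p0 : (0 < 4 / e / (1 - alpha))%R.
      by apply: Rdiv_lt_0_compat; [apply: Rdiv_lt_0_compat|]; lra.
    have -> : (4 / e = (1 - alpha) * exp (ln (4 / e / (1 - alpha))))%R.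
      by rewrite exp_ln //; field; lra.
    apply: Rmult_le_compat_l; first by lra.
    apply: exp_le; have := Rmult_le_compat_l _ _ _ (Rlt_le _ _ kappa0) lnl.
    have -> // : (kappa * (ln (4 / e / (1 - alpha)) / kappa) = ln (4 / e / (1 - alpha)))%R.
    by field; lra.
  apply: Rmult_le_compat => //.
  - by apply: Rmult_le_pos; lra.
  - exact/Rlt_le/exp_pos.
  (* The two errors add up to [(2 - alpha) eps] per unit of [k], so [2 eps] leaves the slack
     [alpha * eps]. *)
  apply: exp_le; have : (0 <= k * (alpha * eps))%R.
    by do 2?apply: Rmult_le_pos; lra.
  move: hv kL; rewrite /L; lra.
have Pe : (P_conn n (K n) g <= / (4 / e) + 2 * (k / INR n.-1))%R.
  apply: P_conn_le => // D gD; apply: connected_le; rewrite ?gD //.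
    by apply: Rdiv_lt_0_compat; lra.
  have := @isolated_mean_ge n (K n) D (ln alpha - eps)%R Kn; rewrite gD => /(_ gt1 hu).
  apply: Rle_trans; apply: Rmult_le_compat_r => //; exact: pos_INR.
have P0 := P_conn_ge0 Kn' gn.
have i4 : (/ (4 / e) = e / 4)%R by field; lra.
have kn : (k / INR n.-1 <= e / 8)%R.
  apply: (Rmult_le_reg_r (INR n.-1)); first by lra.
  rewrite /Rdiv Rmult_assoc Rinv_l; last by lra.
  rewrite n1E; have := Rmult_le_compat_l (e / 8) _ _ ltac:(lra) n2; lra.
by apply: Rabs_def1; lra.
Qed.

End Scaling.

Theorem theorem3p1 (alpha : R) (K : nat -> nat) (c : R) :
  Rlt 0 alpha -> Rlt alpha 1 ->
  Rlt 0 c ->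
  Un_cv (fun n => Rdiv (INR (K n)) (Rmult c (r1 alpha n))) 1 ->
  (Rlt 1 c -> Un_cv (fun n => P_conn n (K n) (gamma_of alpha n)) 1) /\
  (Rlt c 1 -> Un_cv (fun n => P_conn n (K n) (gamma_of alpha n)) 0).
Proof.
by move=> a0 a1 c0 Ksim; split; [exact: P_conn_cvg1|exact: P_conn_cvg0].
Qed.
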